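(* Let $R$ be any associative ring with $1$, let $n\ge 3$, and let $A,B$ be two-sided ideals of $R$. Then $$[E(n,R,A),E(n,R,B)]=[E(n,A),E(n,B)].$$
   Context: For an associative ring $R$ with $1$, $\operatorname{GL}(n,R)$ is the general linear group of degree $n$; $e$ is the identity matrix and $e_{ij}$ the standard matrix units. For $c\in R$ and $1\le i\ne j\le n$, $t_{ij}(c)=e+ce_{ij}$ is the elementary transvection. $E(n,R)$ is the subgroup of $\operatorname{GL}(n,R)$ generated by all $t_{ij}(c)$, $c\in R$, $1\le i\neq j\le n$. For a two-sided ideal $A$ of $R$, $E(n,A)=\langle t_{ij}(a) : a\in A,\ 1\le i\ne j\le n\rangle$, and the relative elementary subgroup $E(n,R,A)$ is the normal closure of $E(n,A)$ in $E(n,R)$. Commutators are $[x,y]=xyx^{-1}y^{-1}$; for subgroups $H,K$ of a group, $[H,K]$ is the subgroup generated by all $[h,k]$, $h\in H$, $k\in K$. *)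

(* Defs.v *)
From HB Require Import structures.
From mathcomp Require Import all_boot all_algebra.
From mathcomp Require Import boolp classical_sets.

Set Implicit Arguments.
Unset Strict Implicit.
Unset Printing Implicit Defensive.

Import GRing.Theory.
Local Open Scope classical_set_scope.
Local Open Scope ring_scope.

Section Groups.
Variable G : groupType.
Implicit Types H K N X : set G.

Definition subgroup H :=
  [/\ H 1%g,
      forall x y, H x -> H y -> H (x * y)%g
    & forall x, H x -> H (x^-1)%g].

Definition generated X : set G := smallest subgroup X.

Definition normal_subgroup H N :=
  [/\ subgroup N, N `<=` H
    & forall h x, H h -> N x -> N (h * x * h^-1)%g].

Definition normal_closure H X : set G := smallest (normal_subgroup H) X.

(* The library's [~ x, y] is x^-1 y^-1 x y. *)
Definition commutator (x y : G) : G := (x * y * x^-1 * y^-1)%g.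

Definition mutual_commutator H K : set G :=
  generated [set commutator h k | h in H & k in K].

End Groups.

(* The ring is neither assumed commutative nor nontrivial, so the library's
   unitmx and {'GL_n[R]} do not apply.  An invertible matrix is stored with its
   two-sided inverse; the latter is unique, so equality in GL amounts to
   equality of matrices (GLmx_inj). *)
Section GeneralLinear.
Variables (R : pzRingType) (n : nat).

Record GL := MkGL {
  GLpair : 'M[R]_n * 'M[R]_n;
  GLpairP : (GLpair.1 *m GLpair.2 == 1%:M) && (GLpair.2 *m GLpair.1 == 1%:M)
}.

HB.instance Definition _ := [isSub for GLpair].
HB.instance Definition _ := [Choice of GL by <:].

Definition GLmx (g : GL) : 'M[R]_n := (GLpair g).1.
Definition GLimx (g : GL) : 'M[R]_n := (GLpair g).2.

Lemma GLmxV g : GLmx g *m GLimx g = 1%:M.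
Proof. by have /andP[/eqP] := GLpairP g. Qed.

Lemma GLVmx g : GLimx g *m GLmx g = 1%:M.
Proof. by have /andP[_ /eqP] := GLpairP g. Qed.

Lemma GLmx_inj : injective GLmx.
Proof.
move=> g h eq_gh; apply: val_inj; rewrite /= (surjective_pairing (GLpair g)).
rewrite (surjective_pairing (GLpair h)); congr pair => //.
change (GLimx g = GLimx h).
by rewrite -[LHS]mulmx1 -(GLmxV h) mulmxA -eq_gh GLVmx mul1mx.
Qed.

Definition GLof (M N : 'M[R]_n) (MN : M *m N = 1%:M) (NM : N *m M = 1%:M) : GL :=
  @MkGL (M, N) (introT andP (conj (introT eqP MN) (introT eqP NM))).

Definition GLone : GL := GLof (mul1mx 1%:M) (mul1mx 1%:M).

Definition GLinv (g : GL) : GL := GLof (GLVmx g) (GLmxV g).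

Lemma GLmul_subproof g h : GLmx g *m GLmx h *m (GLimx h *m GLimx g) = 1%:M.
Proof. by rewrite mulmxA -(mulmxA (GLmx g)) GLmxV mulmx1 GLmxV. Qed.

Lemma GLmul_subproofV g h : GLimx h *m GLimx g *m (GLmx g *m GLmx h) = 1%:M.
Proof. by rewrite mulmxA -(mulmxA (GLimx h)) GLVmx mulmx1 GLVmx. Qed.

Definition GLmul (g h : GL) : GL := GLof (GLmul_subproof g h) (GLmul_subproofV g h).

Lemma GLmulA : associative GLmul.
Proof. by move=> g h k; apply: GLmx_inj; exact: mulmxA. Qed.

Lemma GLmul1g : left_id GLone GLmul.
Proof. by move=> g; apply: GLmx_inj; exact: mul1mx. Qed.

Lemma GLmulg1 : right_id GLone GLmul.
Proof. by move=> g; apply: GLmx_inj; exact: mulmx1. Qed.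

Lemma GLmulVg : left_inverse GLone GLinv GLmul.
Proof. by move=> g; apply: GLmx_inj; exact: GLVmx. Qed.

Lemma GLmulgV : right_inverse GLone GLinv GLmul.
Proof. by move=> g; apply: GLmx_inj; exact: GLmxV. Qed.

HB.instance Definition _ :=
  isGroup.Build GL GLmulA GLmul1g GLmulg1 GLmulVg GLmulgV.

Definition transvection_mx (i j : 'I_n) (c : R) : 'M[R]_n :=
  1%:M + c *: delta_mx i j.

Lemma transvection_mxN (i j : 'I_n) (c : R) : i != j ->
  transvection_mx i j c *m transvection_mx i j (- c) = 1%:M.
Proof.
move=> ij; rewrite /transvection_mx mulmxDl mul1mx mulmxDr mulmx1 scaleNr mulmxN.
suff -> : (c *: delta_mx i j) *m (c *: delta_mx i j) = 0 :> 'M[R]_n.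
  by rewrite subr0 addrNK.
apply/matrixP => k l; rewrite !mxE big1 // => m _; rewrite !mxE.
case: (m =P j) => [->|_]; first by rewrite [j == i]eq_sym (negPf ij) mulr0 mulr0.
by rewrite andbF mulr0 mul0r.
Qed.

Lemma transvection_mxNV (i j : 'I_n) (c : R) : i != j ->
  transvection_mx i j (- c) *m transvection_mx i j c = 1%:M.
Proof. by move=> ij; rewrite -{2}[c]opprK transvection_mxN. Qed.

Definition transvection (i j : 'I_n) (ij : i != j) (c : R) : GL :=
  GLof (transvection_mxN c ij) (transvection_mxNV c ij).

End GeneralLinear.

Definition two_sided_ideal (R : pzRingType) (A : set R) :=
  [/\ A 0,
      forall a b, A a -> A b -> A (a - b),
      forall r a, A a -> A (r * a)
    & forall r a, A a -> A (a * r)].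

Section Elementary.
Variables (R : pzRingType) (n : nat).

(* E(n, A); the absolute group E(n, R) is the case A = setT. *)
Definition elementary (A : set R) : set (GL R n) :=
  generated [set g | exists i j (ij : i != j) (a : R),
                       A a /\ g = transvection ij a].

Definition rel_elementary (A : set R) : set (GL R n) :=
  normal_closure (elementary setT) (elementary A).

End Elementary.

Arguments elementary {R} n A.
Arguments rel_elementary {R} n A.

(* Main.v *)
(**
  Let H = [E(n,A), E(n,B)], t_ij(c) = e + c e_ij, and let J be the set of all c
  such that H contains every conjugate of t_ij(p c q) by t_ji(r).  Then J is a
  two-sided ideal.  It contains AB and BA, because t_ij(ab) = [t_ih(a), t_hj(b)]
  and conjugation by t_ji(r) keeps the two factors in E(n,A) and E(n,B).  Since
  E(n,R,I) is generated by the conjugates of t_ij(c), c in I, by t_ji(r), we get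
  E(n,R,J) <= H.

  Modulo E(n,R,J), the commutators [t_ij(a), t_ji(b)] commute with t_kl(r) for
  {k,l} <> {i,j}, hence with all of E(n,R) as n >= 3.  So H/E(n,R,J) is central,
  and H is normal in E(n,R).

  Modulo H, each t_kl(b)^t_lk(r) commutes with E(n,A).  Against t_ij(a) with
  (i,j) <> (k,l) one conjugates back by t_lk(r); against t_kl(a) one writes
  t_kl(b) = [t_kh(b), t_hl(1)].  Hence E(n,R,B) centralizes E(n,A), and, being
  normal, also E(n,R,A), modulo H.
*)
Require Import Defs.
From mathcomp Require Import all_boot all_algebra.
From mathcomp Require Import boolp classical_sets.

Set Implicit Arguments.
Unset Strict Implicit.
Unset Printing Implicit Defensive.

Import GRing.Theory.
Local Open Scope classical_set_scope.
Local Open Scope group_scope.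

(** * Centralizers modulo a normal subgroup *)

Section CentralizersModulo.
Variable G : groupType.
Implicit Types (H K N X Y : set G) (x y g h : G).

Lemma subgroupJ H x g : subgroup H -> H x -> H g -> H (x ^ g).
Proof. by case=> _ HM HV Hx Hg; apply: (HM); [exact: HV | exact: HM]. Qed.

Lemma normal_subgroupJ H N x g :
  subgroup H -> normal_subgroup H N -> H g -> N x -> N (x ^ g).
Proof.
move=> [_ _ HV] [_ _ HN] /HV Hg Nx.
by have := HN _ _ Hg Nx; rewrite invgK -mulgA.
Qed.

Lemma subgroup_preimJ H g : subgroup H -> subgroup [set x | H (x ^ g)].
Proof.
case=> H1 HM HV; split=> /=; first by rewrite conj1g.
- by move=> x y Hx Hy; rewrite conjMg; exact: HM.
- by move=> x Hx; rewrite conjVg; exact: HV.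
Qed.

Lemma subgroup_generated X : subgroup (generated X).
Proof.
split=> [M [[M1 _ _] _] //|x y Xx Xy M MX|x Xx M MX]; case: (MX) => -[_ MM MV] _.
- by apply: (MM); [exact: Xx | exact: Xy].
- by apply: MV; exact: Xx.
Qed.

Lemma generated_sub X H : subgroup H -> X `<=` H -> generated X `<=` H.
Proof. exact: smallest_sub. Qed.

Lemma normal_subgroup_generated T X : (forall t, T t -> T t^-1) ->
  X `<=` generated T -> (forall t x, T t -> X x -> generated X (x ^ t)) ->
  normal_subgroup (generated T) (generated X).
Proof.
move=> TV XT XJ; have sX := subgroup_generated X.
(* Asking for stability under both [g] and [g^-1] makes [N] closed under inversion. *)
pose N := [set g | forall x, generated X x ->
                   generated X (x ^ g) /\ generated X (x ^ g^-1)].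
have XTJ t x : T t -> generated X x -> generated X (x ^ t).
  move=> Tt; apply: (@generated_sub X [set y | generated X (y ^ t)]).
    exact: subgroup_preimJ.
  by move=> y Xy; exact: XJ.
have TN : generated T `<=` N.
  apply: generated_sub => [|t Tt x Xx]; last first.
    by split; apply: XTJ => //; exact: TV.
  split=> [x Xx|g g' Ng Ng' x Xx|g Ng x /Ng[]]; last by rewrite invgK.
    by rewrite invg1 !conjg1.
  rewrite invgM !conjgM; split.
    by apply: (Ng' _ (Ng _ Xx).1).1.
  by apply: (Ng _ (Ng' _ Xx).2).2.
split=> // [|h x Th Xx].
  by apply: generated_sub => //; exact: subgroup_generated.
by have [_] := TN _ Th _ Xx; rewrite /conjg invgK mulgA.
Qed.

Lemma normal_closure_normal H X : subgroup H -> X `<=` H ->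
  normal_subgroup H (normal_closure H X).
Proof.
move=> sH XH.
have HH : normal_subgroup H H.
  by split=> // h x Hh Hx; case: sH => _ HM HV; apply: (HM); [exact: HM | exact: HV].
split; last 1 first.
- move=> h x Hh Xx M MX; case: (MX) => -[_ _ MJ] _.
  by apply: MJ => //; exact: Xx.
- split=> [M [[[M1 _ _] _ _] _] //|x y Xx Xy M MX|x Xx M MX];
    case: (MX) => -[[_ MM MV] _ _] _.
  + by apply: (MM); [exact: Xx | exact: Xy].
  + by apply: MV; exact: Xx.
- by move=> x; apply; split.
Qed.

Lemma commutator_conj x y g : commutator (x ^ g) (y ^ g) = commutator x y ^ g.
Proof. by rewrite /commutator -!conjVg -!conjMg. Qed.

Lemma commutatorV x y : (commutator x y)^-1 = commutator y x.
Proof. by rewrite /commutator !invgM !invgK !mulgA. Qed.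

Lemma commutator1 x y : x * y = y * x -> commutator x y = 1.
Proof. by move=> xy; rewrite /commutator xy mulgK mulgV. Qed.

Lemma subgroup_commutator H x y :
  subgroup H -> H x -> H y -> H (commutator x y).
Proof. by case=> _ HM HV Hx Hy; do !apply: (HM) => //; exact: HV. Qed.

(** For [N] normal in [H] and [Y] inside [H], this is the preimage in [H] of the centralizer of the
    image of [Y] in [H / N]. *)
Definition cent_mod N H Y : set G :=
  [set x | H x /\ forall y, Y y -> N (commutator x y)].

Variables H N : set G.
Hypotheses (sH : subgroup H) (nN : normal_subgroup H N).

Lemma subgroup_cent_mod Y : Y `<=` H -> subgroup (cent_mod N H Y).
Proof.
move=> YH; have [[N1 NM NV] _ _] := nN; have [H1 HM HV] := sH; split.
- by split=> // y _; rewrite commutator1 ?mulg1 ?mul1g.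
- move=> x x' [Hx xN] [Hx' x'N]; split; first exact: HM.
  move=> y Yy; have -> : commutator (x * x') y =
      commutator x' y ^ x^-1 * commutator x y.
    by rewrite /commutator /conjg !gnorm.
  by apply: (NM); [apply: (normal_subgroupJ sH nN); [exact: HV | exact: x'N] |
                 exact: xN].
- move=> x [Hx xN]; split; first exact: HV.
  move=> y Yy; have -> : commutator x^-1 y = (commutator x y)^-1 ^ x.
    by rewrite /commutator /conjg !gnorm.
  by apply: (normal_subgroupJ sH nN) => //; apply: NV; exact: xN.
Qed.

Lemma normal_cent_mod Y : Y `<=` H -> (forall g y, H g -> Y y -> Y (y ^ g)) ->
  normal_subgroup H (cent_mod N H Y).
Proof.
move=> YH YJ; have [_ HM HV] := sH; split=> [|x []//|h x Hh [Hx xN]].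
  exact: subgroup_cent_mod.
split=> [|y Yy]; first by apply: (HM); [exact: HM | exact: HV].
have -> : commutator (h * x * h^-1) y = commutator x (y ^ h) ^ h^-1.
  by rewrite /commutator /conjg !gnorm.
apply: (normal_subgroupJ sH nN); first exact: HV.
by apply: xN; exact: YJ.
Qed.

Lemma commutator_modV x y : H x -> H y ->
  N (commutator x y^-1) -> N (commutator x y).
Proof.
move=> Hx Hy Nxy; have [[_ _ NV] _ _] := nN; have [_ _ HV] := sH.
have -> : commutator x y = (commutator x y^-1)^-1 ^ y^-1.
  by rewrite /commutator /conjg !gnorm.
by apply: (normal_subgroupJ sH nN); [exact: HV | exact: NV].
Qed.

Lemma commutator_modC x y : N (commutator x y) -> N (commutator y x).
Proof. by have [[_ _ NV] _ _] := nN; rewrite -(commutatorV x); exact: NV. Qed.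

Lemma sub_cent_mod : N `<=` cent_mod N H H.
Proof.
move=> x Nx; have [[_ NM NV] NH _] := nN; have [_ _ HV] := sH.
split=> [|y Hy]; first exact: NH.
have -> : commutator x y = x * x^-1 ^ y^-1 by rewrite /commutator /conjg !gnorm.
by apply: (NM) => //; apply: (normal_subgroupJ sH nN); [exact: HV | exact: NV].
Qed.

Lemma commutatorMr_mod x w w' : H x -> H w -> N (commutator x w') ->
  N (commutator x (w * w') * (commutator x w)^-1).
Proof.
move=> Hx Hw Nxw'; have [_ HM HV] := sH.
have -> : commutator x (w * w') * (commutator x w)^-1 =
   commutator x w' ^ (w^-1 * (commutator x w)^-1).
  by rewrite /commutator /conjg !gnorm.
apply: (normal_subgroupJ sH nN) => //.
by apply: (HM); rewrite ?commutatorV /commutator; do ?apply: (HM); do ?exact: HV.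
Qed.

End CentralizersModulo.

(** * Relations among transvections *)

Section Transvections.
Variables (R : pzRingType) (n : nat).
Implicit Types (i j k l h : 'I_n) (c d r s : R) (A B I : set R).
Local Notation GL := (GL R n).

(* Made total by sending the degenerate case [i = j] to [1]. *)
Definition tv i j c : GL :=
  if boolP (i != j) is AltTrue ij then transvection ij c else 1.

Lemma tvE i j (ij : i != j) c : transvection ij c = tv i j c.
Proof.
rewrite /tv; case: {-}_ / boolP => [ij'|]; last by rewrite ij.
by rewrite (bool_irrelevance ij ij').
Qed.

Lemma tvii i c : tv i i c = 1.
Proof. by rewrite /tv; case: {-}_ / boolP => // ii; have := ii; rewrite eqxx. Qed.

Lemma GLmx_tv i j c : i != j -> GLmx (tv i j c) = (1%:M + c *: delta_mx i j)%R.
Proof. by move=> ij; rewrite -(tvE ij). Qed.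

Lemma mul_scaled_delta i j k l c d :
  ((c *: delta_mx i j) *m (d *: delta_mx k l) =
   (if j == k then (c * d)%R else 0%R) *: delta_mx i l :> 'M[R]_n)%R.
Proof.
apply/matrixP => p q; rewrite !mxE (bigD1 j) //= big1 => [|m /negPf mj].
  rewrite addr0 !mxE eqxx andbT.
  case: (j =P k) => _; case: (p == i); case: (q == l);
    by rewrite /= ?mulr1 ?mulr0 ?mul0r.
by rewrite !mxE mj andbF mulr0 mul0r.
Qed.

Lemma tv0 i j : tv i j 0%R = 1.
Proof.
case: (eqVneq i j) => [->|ij]; first exact: tvii.
by apply: GLmx_inj; rewrite GLmx_tv // scale0r addr0.
Qed.

Lemma tvD i j c d : tv i j (c + d)%R = tv i j c * tv i j d.
Proof.
case: (eqVneq i j) => [->|ij]; first by rewrite !tvii mulg1.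
apply: GLmx_inj; change (GLmx (tv i j (c + d)%R) = GLmx (tv i j c) *m GLmx (tv i j d))%R.
rewrite !GLmx_tv // mulmxDl mul1mx mulmxDr mulmx1 mul_scaled_delta.
by rewrite eq_sym (negPf ij) scale0r addr0 scalerDl [(c *: _ + _)%R]addrC addrA.
Qed.

Lemma tvN i j c : tv i j (- c)%R = (tv i j c)^-1.
Proof. by apply/esym/mulg1_eq; rewrite -tvD subrr tv0. Qed.

Lemma tvC i j k l c d : i != l -> j != k ->
  tv i j c * tv k l d = tv k l d * tv i j c.
Proof.
move=> il jk; case: (eqVneq i j) => [->|ij]; first by rewrite !tvii mulg1 mul1g.
case: (eqVneq k l) => [->|kl]; first by rewrite !tvii mulg1 mul1g.
apply: GLmx_inj.
change (GLmx (tv i j c) *m GLmx (tv k l d) = GLmx (tv k l d) *m GLmx (tv i j c))%R.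
rewrite !GLmx_tv // !mulmxDl !mul1mx !mulmxDr !mulmx1 !mul_scaled_delta.
by rewrite (negPf jk) eq_sym (negPf il) !scale0r !addr0 addrAC.
Qed.

(** The Steinberg relation without inverses; [tvJr], [tvJl] and [commutator_tv] are derived from
    it. *)
Lemma tvM i j l c d : i != l -> i != j -> j != l ->
  tv i j c * tv j l d = tv j l d * tv i j c * tv i l (c * d)%R.
Proof.
move=> il ij jl; apply: GLmx_inj.
change (GLmx (tv i j c) *m GLmx (tv j l d) =
  GLmx (tv j l d) *m GLmx (tv i j c) *m GLmx (tv i l (c * d)))%R.
rewrite !GLmx_tv // !mulmxDl !mul1mx !mulmxDr !mulmx1 !mul_scaled_delta eqxx.
rewrite [l == i]eq_sym (negPf il) !scale0r !addr0 mulmxDl mul1mx.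
rewrite !mul_scaled_delta [l == i]eq_sym (negPf il) [j == i]eq_sym (negPf ij).
by rewrite !scale0r !addr0 [LHS]addrAC !addrA.
Qed.

Lemma tvJC i j k l c r : i != l -> j != k -> tv i j c ^ tv k l r = tv i j c.
Proof. by move=> il jk; rewrite /conjg tvC // mulKg. Qed.

Lemma tvJr i j l c r : i != j -> i != l -> j != l ->
  tv i j c ^ tv j l r = tv i j c * tv i l (c * r)%R.
Proof. by move=> ij il jl; rewrite /conjg tvM // -mulgA mulKg. Qed.

Lemma tvJl i j k c r : i != j -> k != i -> k != j ->
  tv i j c ^ tv k i r = tv i j c * tv k j (- (r * c))%R.
Proof.
move=> ij ki kj; rewrite /conjg -tvN mulgA tvM // mulNr -[LHS]mulgA.
by rewrite (tvC _ r ki) 1?eq_sym // mulgA tvN mulgVK.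
Qed.

Lemma commutator_tv i j l c d : i != j -> i != l -> j != l ->
  commutator (tv i j c) (tv j l d) = tv i l (c * d)%R.
Proof.
move=> ij il jl; rewrite /commutator tvM // -(mulgA (tv j l d)).
rewrite (tvC c) //; last by rewrite eq_sym.
by rewrite mulgA (tvC d) ?mulgK // eq_sym.
Qed.

End Transvections.

(** * Closure properties of two-sided ideals *)

Section Ideals.
Variables (R : pzRingType) (I : set R).
Hypothesis idealI : two_sided_ideal I.

Lemma tsideal0 : I 0%R. Proof. by case: idealI. Qed.

Lemma tsidealMl r c : I c -> I (r * c)%R.
Proof. by case: idealI => _ _ + _; apply. Qed.

Lemma tsidealMr r c : I c -> I (c * r)%R.
Proof. by case: idealI => _ _ _; apply. Qed.

Lemma tsidealB c d : I c -> I d -> I (c - d)%R.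
Proof. by case: idealI => _ + _ _; apply. Qed.

Lemma tsidealN c : I c -> I (- c)%R.
Proof. by move=> Ic; rewrite -sub0r; exact: (tsidealB tsideal0). Qed.

Lemma tsidealD c d : I c -> I d -> I (c + d)%R.
Proof. by move=> Ic Id; rewrite -[d]opprK; apply: tsidealB => //; exact: tsidealN. Qed.

End Ideals.

(** * Elementary subgroups and conjugation by a single transvection *)

Section ElementaryGroups.
Variables (R : pzRingType) (n : nat).
Implicit Types (i j k l h : 'I_n) (c d r s : R) (A B I : set R).
Local Notation E := (@elementary R n).
Local Notation tv := (@tv R n).

Lemma subgroup_elementary I : subgroup (E I).
Proof. exact: subgroup_generated. Qed.

Lemma tv_elementary I i j c : I c -> E I (tv i j c).
Proof.
move=> Ic; case: (eqVneq i j) => [->|ij].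
  by rewrite tvii; case: (subgroup_elementary I).
by apply: sub_gen_smallest; exists i, j, ij, c; rewrite (tvE ij).
Qed.

Lemma tv_elementaryT i j c : E setT (tv i j c).
Proof. exact: tv_elementary. Qed.

Lemma elementary_sub I (H : set (GL R n)) : subgroup H ->
  (forall i j c, i != j -> I c -> H (tv i j c)) -> E I `<=` H.
Proof.
move=> sH IH; rewrite /elementary; apply: generated_sub => // _ [i [j [ij [c [Ic ->]]]]].
by rewrite (tvE ij); exact: IH.
Qed.

Lemma elementary_subT I : E I `<=` E setT.
Proof.
by apply: (elementary_sub (subgroup_elementary _)) => *; exact: tv_elementaryT.
Qed.

(** Away from the opposite position (j, i), the conjugate is [tv i j c] itself or its product with
    one transvection of parameter c r or - r c. *)
Lemma elementaryJ I i j k l c r : two_sided_ideal I -> I c ->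
  (k != j) || (l != i) -> E I (tv i j c ^ tv k l r).
Proof.
move=> idI Ic kl_ji; have EI := tv_elementary _ _ Ic.
have [_ EM _] := subgroup_elementary I.
case: (eqVneq i j) => [->|ij]; first by rewrite tvii conj1g -(tvii j c).
case: (eqVneq k l) => [->|kl]; first by rewrite tvii conjg1.
have [kj|kj] := eqVneq k j.
  rewrite {}kj eqxx /= in kl kl_ji *; rewrite tvJr 1?[i == l]eq_sym //.
  by apply: (EM) => //; apply: tv_elementary; exact: tsidealMr.
have [li|li] := eqVneq l i; last by rewrite tvJC // eq_sym.
rewrite {}li in kl *; rewrite tvJl //; apply: (EM) => //.
by apply: tv_elementary; apply: (tsidealN idI); exact: tsidealMl.
Qed.

Lemma rel_elementary_normal I : normal_subgroup (E setT) (rel_elementary n I).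
Proof.
by apply: normal_closure_normal; [exact: subgroup_elementary|exact: elementary_subT].
Qed.

End ElementaryGroups.

(** * Generators of the relative elementary subgroup *)

Section Generation.
Variables (R : pzRingType) (n : nat).
Hypothesis n_ge3 : (3 <= n)%N.
Implicit Types (i j k l h : 'I_n) (c d r s : R) (A B I : set R).
Local Notation E := (@elementary R n).
Local Notation tv := (@tv R n).

(** The bound [n_ge3] acts through this lemma: later splittings of a transvection into a commutator
    pass through such an [h]. *)
Lemma third_index i j : exists2 h, h != i & h != j.
Proof.
have := cardC (pred2 i j); rewrite card2 card_ord => card_n.
have /card_gt0P[h] : (0 < #|predC (pred2 i j)|)%N.
  by have := leq_trans n_ge3 (eq_leq (esym card_n)); case: (i != j) => /=; case: #|_|.
by rewrite !inE negb_or => /andP[hi hj]; exists h.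
Qed.

Definition ztv i j c r := tv i j c ^ tv j i r.

(** For an ideal [I] this is E(n, R, I); the substantial inclusion is
    [rel_elementary_sub_zgroup]. *)
Definition zgroup I : set (GL R n) :=
  generated [set g | exists i j c r, [/\ i != j, I c & g = ztv i j c r]].

Lemma subgroup_zgroup I : subgroup (zgroup I).
Proof. exact: subgroup_generated. Qed.

Lemma zgroup_ztv I i j c r : i != j -> I c -> zgroup I (ztv i j c r).
Proof. by move=> ij Ic; apply: sub_gen_smallest; exists i, j, c, r. Qed.

Lemma elementary_zgroup I : E I `<=` zgroup I.
Proof.
apply: (elementary_sub (subgroup_zgroup I)) => i j c ij Ic.
by have := zgroup_ztv 0%R ij Ic; rewrite /ztv tv0 conjg1.
Qed.

(** A generator at the opposite position becomes a [ztv]; any other one stays in E(n, I). Only one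
    such conjugation can be made, since the result may leave E(n, I). *)
Lemma elementaryJ_zgroup I i j r x : two_sided_ideal I ->
  E I x -> zgroup I (x ^ tv i j r).
Proof.
move=> idI; apply: (@elementary_sub _ _ _ [set x | zgroup I (x ^ tv i j r)]).
  exact/subgroup_preimJ/subgroup_zgroup.
move=> k l c kl Ic /=; have [/andP[/eqP-> /eqP->]|] := boolP ((i == l) && (j == k)).
  exact: zgroup_ztv.
by rewrite negb_and => ij_lk; apply: elementary_zgroup; exact: elementaryJ.
Qed.

(* Here [tv k l s] is opposite to the conjugating [tv l k r]; splitting
   [tv k l c] as a commutator through a third index [h] avoids this position. *)
Lemma ztvJ_opposite I k l c r s : two_sided_ideal I -> I c -> k != l ->
  zgroup I (ztv k l c r ^ tv k l s).
Proof.
move=> idI Ic kl; have [h hk hl] := third_index k l.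
have lk : l != k by rewrite eq_sym.
have kh : k != h by rewrite eq_sym.
have lh : l != h by rewrite eq_sym.
have [_ QM QV] := subgroup_zgroup I; have [_ EM EV] := subgroup_elementary n I.
set g := tv l k r * tv k l s; rewrite /ztv -conjgM -/g.
have -> : tv k l c = tv k h c * (tv k h c)^-1 ^ (tv h l (-1))%R.
  rewrite -[c in LHS]mulr1 -(commutator_tv c 1 kh kl hl) tvN /commutator /conjg.
  by rewrite !gnorm.
have [c1 [c2 [Ic1 Ic2 eu]]] : exists c1 c2,
    [/\ I c1, I c2 & tv k h c ^ g = tv k h c1 * tv l h c2].
  (* Conjugation by [tv l k r] creates a factor at (l, h) with parameter - r c, from which
     [tv k l s] produces the extra s r c at (k, h). *)
  exists (c + s * (r * c))%R, (- (r * c))%R.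
  split; first by apply: (tsidealD idI) => //; do 2!apply: (tsidealMl idI).
    by apply: (tsidealN idI); exact: (tsidealMl idI).
  rewrite /g conjgM tvJl // conjMg tvJC // tvJl // mulrN opprK.
  by rewrite tvC // tvD -mulgA.
have [a [b ev]] : exists a b, tv h l (-1)%R ^ g = tv h l a * tv h k b.
  exists (-1 - r * s)%R, (-r)%R.
  rewrite /g conjgM tvJr // conjMg tvJC // tvJr // mulN1r mulNr.
  by rewrite tvC // mulgA -tvD.
have Eu : E I (tv k h c ^ g).
  by rewrite eu; apply: (EM); exact: tv_elementary.
rewrite conjMg conjJg conjVg ev.
apply: (QM); first exact: elementary_zgroup.
rewrite conjVg; apply: QV; rewrite eu conjMg; apply: (QM).
  rewrite conjgM; apply: elementaryJ_zgroup => //.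
  by apply: elementaryJ => //; rewrite lk orbT.
(* The two conjugating transvections commute. The one opposite to the conjugated element has to act
   last, so here, unlike for the first factor, they are swapped. *)
rewrite tvC // conjgM; apply: elementaryJ_zgroup => //.
by apply: elementaryJ => //; rewrite kl orbT.
Qed.

Lemma ztvJ I i j k l c r s : two_sided_ideal I -> I c -> k != l ->
  zgroup I (ztv k l c r ^ tv i j s).
Proof.
move=> idI Ic kl; have lk : l != k by rewrite eq_sym.
have [->|ij] := eqVneq i j; first by rewrite tvii conjg1; exact: zgroup_ztv.
(* Moving [tv l k r] to the right of [tv i j s] leaves it as the last conjugation, so it suffices
   that the replacement [g] keeps [tv k l c] in E(n, I). *)
have swap g : tv l k r * tv i j s = g * tv l k r -> E I (tv k l c ^ g) ->
    zgroup I (ztv k l c r ^ tv i j s).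
  by move=> eg Eg; rewrite /ztv -conjgM eg conjgM; exact: elementaryJ_zgroup.
have Ec : E I (tv k l c) by exact: tv_elementary.
have [ik|ik] := eqVneq i k; have [jl|jl] := eqVneq j l.
- by rewrite ik jl; exact: ztvJ_opposite.
- rewrite {i}ik in ij swap *; have lj : l != j by rewrite eq_sym.
  apply: (swap (tv k j s * tv l j (r * s)%R)).
    by rewrite tvM // -[LHS]mulgA [X in _ * X = _]tvC // 1?eq_sym // mulgA.
  rewrite conjgM tvJC //; apply: elementaryJ => //.
  by rewrite [j == k]eq_sym ij orbT.
- rewrite {j}jl in ij swap *; have ki : k != i by rewrite eq_sym.
  have li : l != i by rewrite eq_sym.
  apply: (swap (tv i l s * tv i k (- (s * r))%R)).
    rewrite conjgC tvJl //; rewrite [X in _ * X = _]tvC // ?mulgA //.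
  rewrite conjgM tvJC //; by apply: elementaryJ => //; rewrite ij.
- have [/andP[/eqP-> /eqP->]|] := boolP ((i == l) && (j == k)).
    by rewrite /ztv -conjgM -tvD; exact: zgroup_ztv.
  rewrite negb_and => ij_lk.
  apply: (swap (tv i j s)).
    by rewrite tvC // eq_sym.
  exact: elementaryJ.
Qed.
Lemma zgroup_normal I : two_sided_ideal I -> normal_subgroup (E setT) (zgroup I).
Proof.
move=> idI; apply: normal_subgroup_generated.
- move=> _ [i [j [ij [c [_ ->]]]]]; exists i, j, ij, (- c)%R.
  by rewrite !tvE tvN.
- move=> _ [i [j [c [r [_ _ ->]]]]].
  by apply: (subgroupJ (subgroup_elementary _ _)); exact: tv_elementaryT.
- move=> _ _ [i [j [ij [s [_ ->]]]]] [k [l [c [r [kl Ic ->]]]]].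
  by rewrite tvE; exact: ztvJ.
Qed.

Lemma rel_elementary_sub_zgroup I :
  two_sided_ideal I -> rel_elementary n I `<=` zgroup I.
Proof.
move=> idI; apply: smallest_sub; first exact: zgroup_normal.
exact: elementary_zgroup.
Qed.

(** In t_ij(r) = [t_ih(r), t_hj(1)] both factors avoid the positions (i, j) and (j, i). Applied to a
    centralizer, this removes the need to test these two positions. *)
Lemma tv_commutator_subgroup (H : set (GL R n)) i j r : subgroup H ->
  (forall k l s, k != l -> (k, l) != (i, j) -> (k, l) != (j, i) -> H (tv k l s)) ->
  i != j -> H (tv i j r).
Proof.
move=> sH Htv ij; have [h hi hj] := third_index i j.
have ih : i != h by rewrite eq_sym.
rewrite -[r]mulr1 -(commutator_tv r 1 ih ij hj).
by apply: (subgroup_commutator sH); apply: Htv;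
  rewrite // xpair_eqE ?(negPf hi) ?(negPf hj) ?andbF // (negPf ij).
Qed.

(** * Commutators of elementary transvections modulo a normal subgroup *)

Section CentralModulo.
Variables (F : set (GL R n)) (A B : set R).
Hypotheses (nF : normal_subgroup (E setT) F) (idB : two_sided_ideal B).
Hypothesis FAB : forall i j a b, i != j -> A a -> B b -> F (tv i j (a * b)%R).
Hypothesis FBA : forall i j a b, i != j -> A a -> B b -> F (tv i j (b * a)%R).

Lemma commutator_tv_mod i j k l a b : i != j -> k != l -> (k, l) != (j, i) ->
  A a -> B b -> F (commutator (tv i j a) (tv k l b)).
Proof.
move=> ij kl klji Aa Bb; have [[F1 _ FV] _ _] := nF.
have [jk|jk] := eqVneq j k.
  rewrite -{}jk in kl klji *; rewrite xpair_eqE eqxx /= eq_sym in klji.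
  by rewrite commutator_tv //; exact: FAB.
have [li|li] := eqVneq l i; last by rewrite commutator1 // tvC // eq_sym.
rewrite {}li in kl klji *; rewrite -commutatorV; apply: FV.
by rewrite commutator_tv // 1?eq_sym //; apply: FBA; rewrite // eq_sym.
Qed.

(** As k != j and l != i, conjugation by [tv k l (- r)] fixes [tv i j a] and at most multiplies
    [tv j i b] by a transvection with parameter in [B], not opposite to (i, j). That factor commutes
    with [tv i j a] modulo [F]. *)
Lemma commutator_opposite_half i j k l a b r : i != j -> k != l ->
  (k, l) != (i, j) -> k != j -> l != i -> A a -> B b ->
  F (commutator (tv k l r) (commutator (tv i j a) (tv j i b))).
Proof.
move=> ij kl klij kj li Aa Bb; set y := commutator _ (tv j i b).
have ji : j != i by rewrite eq_sym.
have sE := subgroup_elementary n (@setT R).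
have ET := @tv_elementaryT R n; have [[F1 _ _] _ _] := nF.
have -> : commutator (tv k l r) y = y ^ tv k l (- r)%R * y^-1.
  by rewrite tvN /commutator /conjg !gnorm.
rewrite -commutator_conj tvJC // 1?eq_sym //.
have [ki|ki] := eqVneq k i.
  rewrite {}ki xpair_eqE eqxx /= in klij kl *.
  rewrite tvJr // 1?[j == l]eq_sym // 1?[i == l]eq_sym //.
  apply: (commutatorMr_mod sE nF) => //; apply: commutator_tv_mod => //.
  - by rewrite eq_sym.
  - by rewrite xpair_eqE (negPf li) andbF.
  - exact: tsidealMr.
have [lj|lj] := eqVneq l j.
  rewrite {}lj in klij kl *; rewrite tvJl //.
  apply: (commutatorMr_mod sE nF) => //; apply: commutator_tv_mod => //.
  - by rewrite xpair_eqE (negPf kj).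
  - by apply: (tsidealN idB); exact: tsidealMl.
by rewrite tvJC 1?eq_sym // mulgV.
Qed.

End CentralModulo.

Lemma commutator_opposite_mod (F : set (GL R n)) A B i j a b x :
  normal_subgroup (E setT) F -> two_sided_ideal A -> two_sided_ideal B ->
  (forall i j a b, i != j -> A a -> B b -> F (tv i j (a * b)%R)) ->
  (forall i j a b, i != j -> A a -> B b -> F (tv i j (b * a)%R)) ->
  i != j -> A a -> B b -> E setT x ->
  F (commutator x (commutator (tv i j a) (tv j i b))).
Proof.
move=> nF idA idB FAB FBA ij Aa Bb; set y := commutator _ (tv j i b).
have sE := subgroup_elementary n (@setT R).
have ET := @tv_elementaryT R n.
have Ey : E setT y by apply: (subgroup_commutator sE); exact: ET.
have yE : [set y] `<=` E setT by move=> _ ->.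
have sC := subgroup_cent_mod sE nF yE.
suff: E setT `<=` cent_mod F (E setT) [set y] by move=> sub /sub[_]; exact.
have easy k l s : k != l -> (k, l) != (i, j) -> (k, l) != (j, i) ->
    cent_mod F (E setT) [set y] (tv k l s).
  move=> kl klij klji; split=> // _ ->.
  have [/andP[kj li]|] := boolP ((k != j) && (l != i)).
    exact: (commutator_opposite_half nF idB FAB FBA).
  rewrite negb_and !negbK => kj_li.
  (* The inverse of [y] is [t_ji(b), t_ij(a)], so the case k = j or l = i follows from the other one
     with [A], [B] and [i], [j] interchanged. *)
  apply: (commutator_modV sE nF) => //; rewrite commutatorV.
  have ji : j != i by rewrite eq_sym.
  have FAB' k' l' b' a' : k' != l' -> B b' -> A a' -> F (tv k' l' (b' * a')%R).
    by move=> *; exact: FBA.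
  have FBA' k' l' b' a' : k' != l' -> B b' -> A a' -> F (tv k' l' (a' * b')%R).
    by move=> *; exact: FAB.
  have [ki lj] : k != i /\ l != j.
    case/orP: kj_li => /eqP e; rewrite {}e in kl klij klji *.
      by split; rewrite // eq_sym.
    by split; rewrite // eq_sym.
  exact: (commutator_opposite_half nF idA FAB' FBA').
apply: (elementary_sub sC) => k l s kl _.
have [/eqP e|kl_ij] := boolP ((k, l) == (i, j)).
  case: e => -> ->; apply: (tv_commutator_subgroup _ sC) => // *; exact: easy.
have [/eqP e|kl_ji] := boolP ((k, l) == (j, i)); last exact: easy.
case: e => -> ->; apply: (tv_commutator_subgroup _ sC) => [*|]; last by rewrite eq_sym.
exact: easy.
Qed.

(** * The mixed commutator subgroup: its conductor, normality and centralizers *)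

Section MixedCommutator.
Variables (A B : set R).
Hypotheses (idA : two_sided_ideal A) (idB : two_sided_ideal B).
Let H := mutual_commutator (E A) (E B).

Let sH : subgroup H. Proof. exact: subgroup_generated. Qed.

Let H_commutator x y : E A x -> E B y -> H (commutator x y).
Proof. by move=> Ax By; apply: sub_gen_smallest; exists x => //; exists y. Qed.

Lemma ztv_commutator_mul i j a b r : i != j -> A a -> B b ->
  H (ztv i j (a * b)%R r) /\ H (ztv i j (b * a)%R r).
Proof.
move=> ij Aa Bb; have [h hi hj] := third_index i j.
have ih : i != h by rewrite eq_sym.
rewrite /ztv -(commutator_tv a b ih ij hj) -(commutator_tv b a ih ij hj).
rewrite -!commutator_conj; split; last first.
  (* For b a the factor from E(n, B) comes first, so the commutator is inverted. *)
  rewrite -commutatorV; have [_ _ HV] := sH; apply: HV.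
  by apply: H_commutator; apply: elementaryJ; rewrite // ?ih ?[j == h]eq_sym ?hj ?orbT.
by apply: H_commutator; apply: elementaryJ; rewrite // ?ih ?[j == h]eq_sym ?hj ?orbT.
Qed.

(* The largest ideal [J] with [E(n, R, J)] contained in [H]. *)
Definition conductor : set R :=
  [set c | forall p q i j r, i != j -> H (ztv i j (p * c * q)%R r)].

(** The multipliers [p] and [q] in [conductor] absorb products on either side; differences follow
    from additivity of [tv] in its parameter. *)
Lemma conductor_ideal : two_sided_ideal conductor.
Proof.
have [H1 HM HV] := sH; split.
- by move=> p q i j r ij; rewrite mulr0 mul0r /ztv tv0 conj1g.
- move=> c d Jc Jd p q i j r ij.
  rewrite mulrBr mulrBl /ztv tvD tvN conjMg conjVg.
  by apply: (HM); [exact: Jc | apply: HV; exact: Jd].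
- by move=> s c Jc p q i j r ij; rewrite mulrA; exact: Jc.
- by move=> s c Jc p q i j r ij; rewrite mulrA -[(_ * q)%R]mulrA; exact: Jc.
Qed.

Lemma zgroup_conductor : zgroup conductor `<=` H.
Proof.
apply: generated_sub => // _ [i [j [c [r [ij Jc ->]]]]].
by have := Jc 1%R 1%R i j r ij; rewrite mul1r mulr1.
Qed.

Lemma conductor_mul a b : A a -> B b -> conductor (a * b)%R /\ conductor (b * a)%R.
Proof.
move=> Aa Bb; split=> p q i j r ij; rewrite mulrA -mulrA.
  by apply: (ztv_commutator_mul _ _ _ _).1 => //; [exact: tsidealMl | exact: tsidealMr].
by apply: (ztv_commutator_mul _ _ _ _).2 => //; [exact: tsidealMr | exact: tsidealMl].
Qed.

Let F := zgroup conductor.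

Let nF : normal_subgroup (E setT) F.
Proof. exact: zgroup_normal conductor_ideal. Qed.

(** The right-hand side is the preimage of the center of E(n, R)/F. It is normal, so centralizing
    modulo it can be tested on generators: opposite pairs are covered by [commutator_opposite_mod],
    and the other commutators lie in [F]. *)
Lemma mutual_commutator_central :
  H `<=` cent_mod F (E setT) (E setT).
Proof.
have sE := subgroup_elementary n (@setT R).
have nK : normal_subgroup (E setT) (cent_mod F (E setT) (E setT)).
  by apply: (normal_cent_mod sE nF) => // g y Eg Ey; exact: (subgroupJ sE).
have sK : subgroup (cent_mod F (E setT) (E setT)) by case: nK.
have genK i j a k l b : i != j -> k != l -> A a -> B b ->
    cent_mod F (E setT) (E setT) (commutator (tv k l b) (tv i j a)).
  move=> ij kl Aa Bb; rewrite -commutatorV; have [_ _ KV] := sK; apply: KV.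
  have FAB i' j' a' b' : i' != j' -> A a' -> B b' -> F (tv i' j' (a' * b')%R).
    move=> _ Aa' Bb'; apply: elementary_zgroup; apply: tv_elementary.
    by have [] := conductor_mul Aa' Bb'.
  have FBA i' j' a' b' : i' != j' -> A a' -> B b' -> F (tv i' j' (b' * a')%R).
    move=> _ Aa' Bb'; apply: elementary_zgroup; apply: tv_elementary.
    by have [] := conductor_mul Aa' Bb'.
  have [/eqP e|klji] := boolP ((k, l) == (j, i)).
    case: e => -> ->; split=> [|x Ex].
      by apply: (subgroup_commutator sE); exact: tv_elementaryT.
    apply: (commutator_modC nF).
    exact: (commutator_opposite_mod nF idA idB FAB FBA).
  by apply: (sub_cent_mod sE nF); exact: (commutator_tv_mod nF FAB FBA).
apply: generated_sub => // _ [x Ax [y By <-]]; apply: (commutator_modC nK).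
have AT := @elementary_subT R n A; have BT := @elementary_subT R n B.
suff BK : E B `<=` cent_mod (cent_mod F (E setT) (E setT)) (E setT) (E A).
  exact: (BK _ By).2.
apply: (elementary_sub (subgroup_cent_mod sE nK AT)) => k l b kl Bb.
split=> [|x' Ax']; first exact: tv_elementaryT.
have tE : [set tv k l b] `<=` E setT by move=> _ ->; exact: tv_elementaryT.
apply: (commutator_modC nK).
suff AK : E A `<=` cent_mod (cent_mod F (E setT) (E setT)) (E setT) [set tv k l b].
  exact: (AK _ Ax').2.
apply: (elementary_sub (subgroup_cent_mod sE nK tE)) => i j a ij Aa.
split=> [|_ ->]; first exact: tv_elementaryT.
by apply: (commutator_modC nK); exact: genK.
Qed.

Lemma mutual_commutator_normal : normal_subgroup (E setT) H.
Proof.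
have [_ HM _] := sH; split=> // [x /mutual_commutator_central[]//|g x Eg Hx].
have -> : g * x * g^-1 = commutator g x * x by rewrite /commutator mulgVK.
apply: (HM) => //; apply: zgroup_conductor; apply: (commutator_modC nF).
exact: (mutual_commutator_central Hx).2.
Qed.

Lemma ztv_cent_mod k l b r : k != l -> B b ->
  cent_mod H (E setT) (E A) (ztv k l b r).
Proof.
move=> kl Bb; have nH := mutual_commutator_normal.
have sE := subgroup_elementary n (@setT R); have [_ _ EV] := sE.
have ET := @tv_elementaryT R n.
have Ez : E setT (ztv k l b r) by apply: (subgroupJ sE); exact: ET.
have zE : [set ztv k l b r] `<=` E setT by move=> _ ->.
split=> // x Ax; apply: (commutator_modC nH).
suff AC : E A `<=` cent_mod H (E setT) [set ztv k l b r] by exact: (AC _ Ax).2.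
apply: (elementary_sub (subgroup_cent_mod sE nH zE)) => {x Ax} i j a ij Aa.
split=> // _ ->.
have [/andP[/eqP-> /eqP->]|] := boolP ((i == k) && (j == l)); last first.
  rewrite negb_and => ij_kl.
  (* Conjugating back by [tv l k r] turns the [ztv] into [tv k l b] and keeps [tv i j a] in E(n, A),
     as (i, j) is not (k, l). *)
  rewrite /ztv -[tv i j a](conjgKV (tv l k r)) commutator_conj.
  apply: (normal_subgroupJ sE nH) => //; apply: H_commutator.
    by rewrite -tvN; apply: elementaryJ; rewrite // ![_ == i]eq_sym ![_ == j]eq_sym orbC.
  exact: tv_elementary.
have [h hk hl] := third_index k l.
have kh : k != h by rewrite eq_sym.
have lk : l != k by rewrite eq_sym.
have lh : l != h by rewrite eq_sym.
(* In the remaining case, t_kl(b) = [t_kh(b), t_hl(1)] conjugated by t_lk(r) becomes [u, v], with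
   [u] in E(n, B). *)
set u := tv k h b ^ tv l k r; set v := tv h l 1%R * tv h k r.
have -> : ztv k l b r = u * u^-1 ^ v^-1.
  have -> : v = tv h l 1%R ^ tv l k r by rewrite tvJr // mul1r.
  rewrite /ztv -[b in LHS]mulr1 -(commutator_tv b 1 kh kl hl).
  by rewrite -commutator_conj /commutator -/u /conjg !gnorm.
have Bu : E B u by apply: elementaryJ; rewrite // lh.
have [_ _ BV] := subgroup_elementary n B.
have uE : E setT u by exact: elementary_subT Bu.
have vE : E setT v by case: sE => _ EM _; apply: (EM).
have BuV : E B u^-1 by exact: BV.
have xE : [set tv k l a] `<=` E setT by move=> _ ->.
suff [_ /(_ _ erefl)] : cent_mod H (E setT) [set tv k l a] (u * u^-1 ^ v^-1).
  exact: (commutator_modC nH).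
have [_ CM _] := subgroup_cent_mod sE nH xE; apply: (CM).
  split=> // _ ->; apply: (commutator_modC nH); apply: H_commutator => //.
  exact: tv_elementary.
split=> [|_ ->].
  by apply: (subgroupJ sE); [exact: elementary_subT BuV | exact: EV].
(* The conjugation by [v^-1] is moved onto [tv k l a], which [v] keeps in E(n, A): neither factor of
   [v] is opposite to (k, l). *)
rewrite -[tv k l a](conjgK v) commutator_conj.
apply: (normal_subgroupJ sE nH); first exact: EV.
apply: (commutator_modC nH); apply: H_commutator => //.
rewrite /v conjgM tvJC //; apply: elementaryJ => //.
by rewrite hl.
Qed.

End MixedCommutator.
End Generation.

(** * Passage to the relative elementary subgroups *)

Theorem theorem2 (R : pzRingType) (n : nat) (A B : set R)
    (n_ge3 : (3 <= n)%N)
    (idealA : two_sided_ideal A) (idealB : two_sided_ideal B) :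
  mutual_commutator (rel_elementary n A) (rel_elementary n B) =
  mutual_commutator (elementary n A) (elementary n B).
Proof.
have sE := subgroup_elementary n (@setT R).
have nH := mutual_commutator_normal n_ge3 idealA idealB.
have sH : subgroup (mutual_commutator (elementary n A) (elementary n B)).
  by case: nH.
have [_ relAT _] := rel_elementary_normal n A.
have nRB := rel_elementary_normal n B; have [_ relBT _] := nRB.
have AT := @elementary_subT R n A.
apply/seteqP; split; last first.
  apply: generated_sub => [|_ [x Ax [y By <-]]]; first exact: subgroup_generated.
  apply: sub_gen_smallest; exists x; first exact: sub_gen_smallest.
  by exists y => //; exact: sub_gen_smallest.
set H := mutual_commutator (elementary n A) (elementary n B) in nH sH *.
have BC : rel_elementary n B `<=` cent_mod H (elementary n setT) (elementary n A).
  move=> y /(rel_elementary_sub_zgroup n_ge3 idealB); move: y.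
  apply: generated_sub => [|_ [k [l [b [r [kl Bb ->]]]]]].
    exact: subgroup_cent_mod.
  exact: ztv_cent_mod.
(* Since E(n, R, B) is normal, so is its centralizer modulo [H]; containing E(n, A), it contains the
   normal closure E(n, R, A). *)
have AC : rel_elementary n A `<=`
    cent_mod H (elementary n setT) (rel_elementary n B).
  apply: smallest_sub.
    apply: (normal_cent_mod sE nH) => // g y Eg By.
    exact: (normal_subgroupJ sE nRB).
  move=> x Ax; split=> [|y By]; first exact: AT.
  by apply: (commutator_modC nH); exact: (BC _ By).2.
apply: generated_sub => // _ [x Ax [y By <-]].
exact: (AC _ Ax).2.
Qed.
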